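(* For all integers $k \geq 1$ and $n\ge 1$, $$\Omega_{2k}(n) = \sum_{m=1}^k R(k,m) \binom{n+m}{2m}.$$
   Context: For integers $k,n\ge 1$, $\Omega_k(n) = \sum_{i=1}^n (-1)^{n-i} i^k = n^k - (n-1)^k + \cdots + (-1)^{n-1} 1^k$. For integers $0 \le m \le k$, the numbers $R(k,m)$ (OEIS A304330) are defined by $$R(k,m) = \sum_{j=0}^m (-1)^j \binom{2m}{j} (m-j)^{2k},$$ with the convention $0^0=1$. Binomial coefficients $\binom{a}{b}$ with integers $0\le a<b$ are $0$. *)

(* Defs.v *)
From mathcomp Require Import all_boot all_order all_algebra.
Set Implicit Arguments.
Unset Strict Implicit.
Unset Printing Implicit Defensive.
Import GRing.Theory.
Local Open Scope ring_scope.

(* The exponent [n - i] is a truncated subtraction, exact here since [i <= n]. *)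
Definition Omega (k n : nat) : int :=
  \sum_(1 <= i < n.+1) (-1) ^+ (n - i) * i%:Z ^+ k.

(* OEIS A304330.  [x ^+ 0 = 1] for every [x], so [0 ^ 0 = 1]. *)
Definition R (k m : nat) : int :=
  \sum_(0 <= j < m.+1) (-1) ^+ j * 'C(2 * m, j)%:Z * (m%:Z - j%:Z) ^+ (2 * k).

(* Main.v *)
Require Import Defs.
From mathcomp Require Import all_boot all_order all_algebra.
From mathcomp Require Import zify ring.
Import GRing.Theory.
Local Open Scope ring_scope.

(** Both sides are determined by their value at [n = 0] and by the sum of two
    consecutive values.  For [Omega (2 * k)] that sum is [n ^+ (2 * k)], so the
    theorem amounts to an expansion of even powers (for [n >= 1]),
      [n ^ 2k = \sum_m R k m * B m n],  [B m n = C(n + m, 2m) + C(n + m - 1, 2m)].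
    Up to the factor [2 / (2m)!], [B m n] is the central factorial
    [n^2 (n^2 - 1) ... (n^2 - (m - 1)^2)], and [R k m] is half of the central
    difference of order [2m] of [x ^ 2k] at [0], so this is Newton's
    interpolation formula for central differences.

    The expansion is proved by induction on [k].  Multiplication by [n^2] acts
    on the basis by [n^2 B_m = m^2 B_m + (2m + 2)(2m + 1) B_(m+1)]
    ([central_basis_rec]), and the central differences satisfy the transposed
    recurrence ([central_diff_rec]).  The induction runs on the full central
    difference, which is twice [R k m] for [k >= 1] ([central_diffE]), because
    at [k = 0] it vanishes for all [m >= 1], whereas the truncated sum [R 0 m]
    does not; the expansion therefore starts at [k = 0] as [2 = 1 * 2]. *)

(** The central difference of order [2m] of [x ^ 2k] at [0]. *)
Definition central_diff (k m : nat) : int :=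
  \sum_(0 <= j < (2 * m).+1)
    (-1) ^+ j * 'C(2 * m, j)%:Z * (m%:Z - j%:Z) ^+ (2 * k).

(** Twice the central factorial of [n.+1], over [(2m)!]; the shifted
    argument avoids a truncated subtraction in [C(n + m - 1, 2m)]. *)
Definition central_basis (m n : nat) : int :=
  'C(n.+1 + m, 2 * m)%:Z + 'C(n + m, 2 * m)%:Z.

(** The truncated [n - m] of [mul_bin_left] becomes an integer difference: for
    [n < m] both binomials are zero. *)
Lemma mul_binz_left (n m : nat) :
  m.+1%:Z * 'C(n, m.+1)%:Z = (n%:Z - m%:Z) * 'C(n, m)%:Z.
Proof.
have [le_mn | lt_nm] := leqP m n.
  by rewrite subzn // -!PoszM mul_bin_left.
by rewrite !bin_small ?mulr0 // ltnW.
Qed.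

Lemma mul_binz_diag (n m : nat) :
  n.+1%:Z * 'C(n, m)%:Z = m.+1%:Z * 'C(n.+1, m.+1)%:Z.
Proof. by rewrite -!PoszM -mul_bin_diag. Qed.

Lemma mul_binz_down (n m : nat) :
  n.+1%:Z * 'C(n, m)%:Z = (n.+1%:Z - m%:Z) * 'C(n.+1, m)%:Z.
Proof. by rewrite mul_binz_diag mul_binz_left. Qed.

Lemma central_basis_rec (m n : nat) :
  n.+1%:Z ^+ 2 * central_basis m n =
  m%:Z ^+ 2 * central_basis m n
  + (2 * m).+2%:Z * (2 * m).+1%:Z * central_basis m.+1 n.
Proof.
rewrite /central_basis.
have -> : (n.+1 + m.+1)%N = (n + m).+2 by lia.
have -> : (n + m.+1)%N = (n + m).+1 by lia.
have -> : (n.+1 + m)%N = (n + m).+1 by lia.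
have -> : (2 * m.+1)%N = (2 * m).+2 by lia.
(* Every binomial reduces to [C(n + m, 2m)]: the one without a direct formula,
   [C(n + 1 + m, 2m)], occurs with the factor [n + 1 - m]. *)
have up : (2 * m).+2%:Z * (2 * m).+1%:Z * 'C((n + m).+2, (2 * m).+2)%:Z
    = (n + m).+2%:Z * (n + m).+1%:Z * 'C(n + m, 2 * m)%:Z.
  by rewrite mulrAC -mul_binz_diag mulrAC -mulrA -mul_binz_diag mulrA.
have mid : (2 * m).+2%:Z * (2 * m).+1%:Z * 'C((n + m).+1, (2 * m).+2)%:Z
    = (n + m).+1%:Z * ((n + m)%:Z - (2 * m)%:Z) * 'C(n + m, 2 * m)%:Z.
  by rewrite mulrAC -mul_binz_diag mulrAC -mulrA mul_binz_left mulrA.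
rewrite [(2 * m).+2%:Z * _ * _]mulrDr up mid.
have low := mul_binz_down (n + m) (2 * m).
move: 'C(n + m, 2 * m)%:Z 'C((n + m).+1, 2 * m)%:Z low => a b low.
have {}low : (n.+1%:Z - m%:Z) * b = (n.+1%:Z + m%:Z) * a.
  have -> : n.+1%:Z + m%:Z = (n + m).+1%:Z :> int by lia.
  by rewrite low; congr (_ * _); lia.
rewrite (_ : (n + m).+2%:Z = n.+1%:Z + m%:Z + 1 :> int); last by lia.
rewrite (_ : (n + m).+1%:Z = n.+1%:Z + m%:Z :> int); last by lia.
rewrite (_ : (n + m)%:Z - (2 * m)%:Z = n.+1%:Z - m%:Z - 1 :> int); last by lia.
move: n.+1%:Z m%:Z low => x y low; apply/eqP; rewrite -subr_eq0; apply/eqP.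
transitivity ((x + y) * ((x - y) * b - (x + y) * a)); first by ring.
by rewrite low subrr mulr0.
Qed.

(** The factor [(m - j)^2] is [m^2 - j (2m - j)], and [j (2m - j)] turns
    [C(2m, j)] into a multiple of [C(2m - 2, j - 1)]; the shift of [j] by one
    keeps [m - j] centred. *)
Lemma central_diff_rec (k m : nat) :
  central_diff k.+1 m.+1 =
  m.+1%:Z ^+ 2 * central_diff k m.+1
  + (2 * m).+2%:Z * (2 * m).+1%:Z * central_diff k m.
Proof.
pose f j : int :=
  (-1) ^+ j * 'C(2 * m.+1, j)%:Z * (m.+1%:Z - j%:Z) ^+ (2 * k).
pose g j : int := j%:Z * ((2 * m).+2%:Z - j%:Z) * f j.
have fE j : (-1) ^+ j * 'C(2 * m.+1, j)%:Z * (m.+1%:Z - j%:Z) ^+ (2 * k.+1)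
    = m.+1%:Z ^+ 2 * f j - g j.
  rewrite /g /f (_ : 2 * k.+1 = 2 + 2 * k)%N 1?exprD; last by lia.
  have -> : (2 * m).+2%:Z = 2 * m.+1%:Z :> int by lia.
  ring.
rewrite /central_diff (eq_bigr _ (fun j _ => fE j)) sumrB -!mulr_sumr.
congr (_ + _).
have -> : (2 * m.+1).+1 = (2 * m).+3 by lia.
(* The two extreme terms carry the factors [j = 0] and [2m + 2 - j = 0]. *)
rewrite big_nat_recl // big_nat_recr //=.
have -> : g 0 = 0 by rewrite /g !mul0r.
have -> : g (2 * m).+2 = 0 by rewrite /g subrr mulr0 mul0r.
rewrite add0r addr0 -sumrN mulr_sumr; apply: eq_bigr => j _.
rewrite /g /f (_ : 2 * m.+1 = (2 * m).+2)%N; last by lia.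
have e1 := mul_binz_diag (2 * m).+1 j.
have e2 := mul_binz_down (2 * m) j.
have e3 : j.+1%:Z * ((2 * m).+2%:Z - j.+1%:Z) * 'C((2 * m).+2, j.+1)%:Z
    = (2 * m).+2%:Z * (2 * m).+1%:Z * 'C(2 * m, j)%:Z.
  rewrite mulrAC -e1 -[RHS]mulrA e2.
  have -> : (2 * m).+2%:Z - j.+1%:Z = (2 * m).+1%:Z - j%:Z :> int by lia.
  ring.
have -> : m.+1%:Z - j.+1%:Z = m%:Z - j%:Z :> int by lia.
rewrite exprS.
transitivity ((-1) ^+ j * (m%:Z - j%:Z) ^+ (2 * k) *
  (j.+1%:Z * ((2 * m).+2%:Z - j.+1%:Z) * 'C((2 * m).+2, j.+1)%:Z)); first by ring.
by rewrite e3; ring.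
Qed.

Lemma central_diff0r (k : nat) : central_diff k 0 = (k == 0%N)%:Z.
Proof.
by rewrite /central_diff big_nat1 subrr expr0 !mul1r expr0n muln_eq0 natz.
Qed.

Lemma central_diff0l (m : nat) : central_diff 0 m.+1 = 0.
Proof.
(* This is the binomial expansion of [(1 - 1) ^+ (2 * m.+1)]. *)
have := exprDn (1 : int) (-1) (2 * m.+1).
rewrite subrr expr0n /= => binom0; rewrite [RHS]binom0 /central_diff big_mkord.
apply: eq_bigr => j _.
by rewrite muln0 expr0 mulr1 expr1n mul1r -mulr_natr natz.
Qed.

(** A difference of order greater than the degree vanishes; through the
    recurrence this comes down to degree [0]. *)
Lemma central_diff_small (k m : nat) : (k < m)%N -> central_diff k m = 0.
Proof.
elim: k m => [|k IHk] [|m] // lt_km; first exact: central_diff0l.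
by rewrite central_diff_rec !IHk ?mulr0 // ltnW.
Qed.

(** The summand is symmetric under [j <-> 2m - j], and for [k >= 1] the middle
    term, which [R k m] contains once, is zero. *)
Lemma central_diffE (k m : nat) : (1 <= k)%N -> central_diff k m = 2 * R k m.
Proof.
move=> k_gt0; rewrite /R /central_diff.
pose f j : int := (-1) ^+ j * 'C(2 * m, j)%:Z * (m%:Z - j%:Z) ^+ (2 * k).
rewrite -/(\sum_(0 <= j < (2 * m).+1) f j) -/(\sum_(0 <= j < m.+1) f j).
have fm : f m = 0 by rewrite /f subrr expr0n muln_eq0 [k == _]eqn0Ngt k_gt0 mulr0.
have fS j : (j <= 2 * m)%N -> f (2 * m - j)%N = f j.
  move=> le_j; rewrite /f bin_sub //; congr (_ * _ * _).
    by rewrite -signr_odd oddB // oddM /= signr_odd.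
  rewrite -subzn // (_ : m%:Z - _ = - (m%:Z - j%:Z)); last by lia.
  by rewrite exprM sqrrN -exprM.
rewrite (@big_cat_nat _ _ _ m.+1) //=; last by lia.
suff -> : \sum_(m.+1 <= j < (2 * m).+1) f j = \sum_(0 <= j < m.+1) f j.
  by rewrite mulr_natl mulr2n.
rewrite [RHS]big_nat_recr //= fm addr0 -{1}(add0n m.+1) big_addn.
have -> : ((2 * m).+1 - m.+1 = m)%N by lia.
rewrite big_nat_rev; apply: eq_big_nat => j /andP[_ lt_jm].
by rewrite -(fS j) ?leq_pmull //; [congr (f _); lia | lia].
Qed.

Lemma central_expansion (k n : nat) :
  2 * n.+1%:Z ^+ (2 * k) =
  \sum_(0 <= m < k.+1) central_diff k m * central_basis m n.
Proof.
elim: k => [|k IHk].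
  by rewrite big_nat1 central_diff0r /central_basis !bin0.
rewrite (_ : 2 * k.+1 = 2 + 2 * k)%N 1?exprD; last by lia.
rewrite mulrCA IHk mulr_sumr.
under eq_bigr => m _ do rewrite mulrCA central_basis_rec mulrDr.
rewrite big_split /= big_nat_recl //.
rewrite [RHS]big_nat_recl // [central_diff k.+1 0]central_diff0r mul0r add0r.
under [RHS]eq_bigr => m _ do rewrite central_diff_rec mulrDl.
rewrite [RHS]big_split /=; congr (_ + _).
  (* The last term on the right is zero, since its order exceeds the degree;
     the term [m = 0] on the left has the factor [m ^+ 2]. *)
  rewrite big_nat_recr //= (central_diff_small _ _ (leqnn k.+1)).
  rewrite !mulr0 mul0r addr0 add0r.
  by apply: eq_bigr => m _; rewrite mulrA [_ * central_diff _ _]mulrC.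
by apply: eq_bigr => m _; rewrite mulrA [_ * central_diff _ _]mulrC.
Qed.

Lemma OmegaS (k n : nat) : Omega k n.+1 = n.+1%:Z ^+ k - Omega k n.
Proof.
rewrite /Omega big_nat_recr //= subnn mul1r addrC -sumrN; congr (_ + _).
apply: eq_big_nat => i /andP[_ le_in].
by rewrite subSn // exprS mulN1r mulNr.
Qed.

Lemma double_Omega (k n : nat) : (1 <= k)%N ->
  2 * Omega (2 * k) n =
  \sum_(0 <= m < k.+1) central_diff k m * 'C(n + m, 2 * m)%:Z.
Proof.
move=> k_gt0; elim: n => [|n IHn].
  rewrite /Omega big_geq // big_nat_recl // central_diff0r eqn0Ngt k_gt0 mul0r.
  by rewrite big1 // => m _; rewrite bin_small ?mulr0 //; lia.
rewrite OmegaS mulrBr IHn central_expansion -sumrB; apply: eq_bigr => m _.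
by rewrite /central_basis -mulrBr addrK.
Qed.

Theorem mainTheorem5 (k n : nat) (hk : (1 <= k)%N) (hn : (1 <= n)%N) :
  Omega (2 * k) n = \sum_(1 <= m < k.+1) R k m * 'C(n + m, 2 * m)%:Z.
Proof.
apply: (@mulfI _ (2 : int)) => //.
rewrite double_Omega // big_ltn // central_diff0r eqn0Ngt hk mul0r add0r.
by rewrite mulr_sumr; apply: eq_bigr => m _; rewrite central_diffE // mulrA.
Qed.
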